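(* Let $G=(V,K)$ be a connected, locally finite graph with infinite vertex set and maximal degree $B=\sup_{i\in V}B_i$, and let $\beta>0$. If $\beta B<2$, then the specification $\gamma^{sc}_{\beta,\alpha}$ of the soft-core Widom-Rowlinson model on $G$ satisfies Dobrushin's condition for every probability measure $\alpha$ on $E=\{-1,0,1\}$.
   Context: $B_i$ is the degree of $i\in V$; $\Omega=E^V$. The soft-core Widom-Rowlinson specification with repulsion $\beta$ and a priori measure $\alpha$ is, for finite $\Lambda\subset V$, $\omega\in E^\Lambda$, $\eta\in E^{V\setminus\Lambda}$, $$\gamma^{sc}_{\Lambda,\beta,\alpha}(\omega|\eta)=\frac1{Z_\eta}\exp\Big(-\beta\sum_{\{i,j\}\in K,\ \{i,j\}\cap\Lambda\neq\emptyset}\mathbf 1(\xi_i\xi_j=-1)\Big)\prod_{i\in\Lambda}\alpha(\omega_i),\qquad \xi=\omega_\Lambda\eta_{V\setminus\Lambda},$$ with $Z_\eta$ the normalization. For a specification $\gamma$ let $\gamma^0_i(\cdot|\eta)$ be the law on $E$ of the spin at $i$ under $\gamma_{\{i\}}(\cdot|\eta_{V\setminus\{i\}})$, and $$C_{ij}(\gamma)=\sup\{d_{TV}(\gamma^0_i(\cdot|\eta),\gamma_i^0(\cdot|\zeta)):\ \eta,\zeta\in\Omega,\ \eta_{V\setminus\{j\}}=\zeta_{V\setminus\{j\}}\},$$ where $d_{TV}(\mu,\nu)=\frac12\sum_{a\in E}|\mu(a)-\nu(a)|$. The Dobrushin constant is $c(\gamma)=\sup_{i\in V}\sum_{j\in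 V}C_{ij}(\gamma)$. $\gamma$ satisfies Dobrushin's condition if $c(\gamma)<1$ and $\gamma$ is quasilocal, i.e. $\gamma_\Lambda(f|\cdot)$ is a uniform limit of local functions (functions depending on finitely many coordinates) whenever $f$ is, for every finite $\Lambda$. *)

(* Defs.v *)
From HB Require Import structures.
From mathcomp Require Import all_boot all_order all_algebra finmap.
From mathcomp Require Import all_classical all_reals all_analysis.
From mathcomp Require Import ring.

Set Implicit Arguments.
Unset Strict Implicit.
Unset Printing Implicit Defensive.

Import Order.TTheory GRing.Theory Num.Theory.
Import numFieldNormedType.Exports.
Local Open Scope classical_set_scope.
Local Open Scope ring_scope.

Section Graph.
Variable V : choiceType.

Record graph := Graph {
  edges :> set {fset V};
  edges_card2 : forall e, edges e -> #|` e| = 2%N }.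

Variable G : graph.

Definition nbrs (i : V) : set V := [set j | edges G [fset i; j]%fset].

Definition locally_finite : Prop := forall i, finite_set (nbrs i).

Definition connected_graph : Prop := forall i j, exists p : seq V,
  path (fun x y => `[< nbrs x y >]) i p /\ last i p = j.

Definition degree (i : V) : nat := #|` fset_set (nbrs i)|.

Definition max_degree (R : realType) : \bar R :=
  ereal_sup [set ((degree i)%:R%:E : \bar R) | i in [set: V]].

Definition edges_meeting (L : {fset V}) : set {fset V} :=
  [set e | edges G e /\ (e `&` L)%fset != fset0].

Lemma edgeP (e : {fset V}) : edges G e ->
  exists i j, i != j /\ e = [fset i; j]%fset.
Proof.
move=> /edges_card2; have := fset_uniq e.
case E: (enum_fset e) => [|i [|j [|? ?]]] //=; rewrite inE andbT => ij _.
exists i, j; split => //; apply/fsetP => v.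
by rewrite !inE -[v \in e]/(v \in enum_fset e) E !inE.
Qed.

Lemma edges_meeting_finite (L : {fset V}) :
  locally_finite -> finite_set (edges_meeting L).
Proof.
move=> lf; apply: (@sub_finite_set _ _
  (\bigcup_(i in [set` L]) ((fun j => [fset i; j]%fset) @` nbrs i))); last first.
  by apply: bigcup_finite => // i _; exact: finite_image.
move=> e [Ge /fset0Pn[i]]; rewrite inE => /andP[ie iL].
exists i => //; have [a [b [_ eE]]] := edgeP Ge.
move: ie Ge; rewrite eE !inE => /orP[/eqP <-|/eqP <-] Ge; first by exists b.
by exists a; rewrite /nbrs /= fsetUC.
Qed.

Lemma edges_meeting_cover (L : {fset V}) : locally_finite ->
  exists F : {fset V}, forall e v, edges_meeting L e -> v \in e -> v \in F.
Proof.
move=> /(edges_meeting_finite L) fin.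
exists (\bigcup_(e <- fset_set (edges_meeting L)) e)%fset => e v Le ve.
by apply/bigfcupP; exists e => //; rewrite andbT in_fset_set // inE.
Qed.

End Graph.

Record fdist (R : realType) (T : finType) := FDist {
  pmf :> T -> R;
  pmf_ge0 : forall a, 0 <= pmf a;
  pmf_sum1 : \sum_(a : T) pmf a = 1 }.

Definition d_TV (R : realType) (T : finType) (m n : T -> R) : R :=
  2^-1 * \sum_(a : T) `|m a - n a|.

Definition spin := seq_sub [:: -1; 0; 1 : int].
HB.instance Definition _ := Finite.on spin.

Lemma zero_in_spin : (0 : int) \in [:: -1; 0; 1 : int]. Proof. by []. Qed.
HB.instance Definition _ := isPointed.Build spin (SeqSub zero_in_spin).

Section Configurations.
Variable V : choiceType.

Definition config := V -> spin.
Definition outside (L : {fset V}) := {v : V | v \notin L}.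

Definition res_in (L : {fset V}) (x : config) : {ffun L -> spin} :=
  [ffun v => x (val v)].

Definition res_out (L : {fset V}) (x : config) : outside L -> spin :=
  fun v => x (val v).

Definition glue (L : {fset V}) (w : {ffun L -> spin}) (h : outside L -> spin) :
    config :=
  fun v => match boolP (v \in L) with
           | AltTrue vL => w [` vL]%fset
           | AltFalse vL => h (exist _ v vL)
           end.

(* Generators of the product sigma-algebra on the spins outside L. *)
Definition cylinders_out (L : {fset V}) : set (set (outside L -> spin)) :=
  [set A | exists v a, A = [set h | h v = a]].

Lemma glue_in (L : {fset V}) w h v (vL : v \in L) :
  @glue L w h v = w [` vL]%fset.
Proof.
rewrite /glue; case: {-}_ / boolP => [vL'|vL']; last by case/negP: (vL').
by rewrite (bool_irrelevance vL' vL).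
Qed.

Lemma glue_out (L : {fset V}) w h v (vL : v \notin L) :
  @glue L w h v = h (exist _ v vL).
Proof.
rewrite /glue; case: {-}_ / boolP => [vL'|vL']; first by case/negP: (vL).
by rewrite (bool_irrelevance vL' vL).
Qed.

Lemma res_in_glue (L : {fset V}) w h : res_in L (@glue L w h) = w.
Proof.
apply/ffunP => v; rewrite ffunE (glue_in _ _ (valP v)).
by congr (w _); apply/val_inj.
Qed.

Lemma res_out_glue (L : {fset V}) w h : @res_out L (@glue L w h) = h.
Proof.
apply/funext => -[v vL]; rewrite /res_out /= (glue_out _ _ vL) //.
Qed.

Lemma glue_res (L : {fset V}) x y : @res_out L x = @res_out L y ->
  glue (res_in L x) (@res_out L y) = x.
Proof.
move=> <-; apply/funext => v; case: (boolP (v \in L)) => vL.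
  by rewrite (glue_in _ _ vL) ffunE.
by rewrite (glue_out _ _ vL).
Qed.

Lemma finitely_dependent_measurable (R : realType) (L : {fset V})
    (g : (outside L -> spin) -> R) (s : seq (outside L)) :
  (forall h k, {in s, h =1 k} -> g h = g k) ->
  measurable_fun setT (g : g_sigma_algebraType (@cylinders_out L) -> R).
Proof.
move=> gs _ Y mY; rewrite setTI.
pose pat (c : {ffun seq_sub s -> spin}) : set (outside L -> spin) :=
  \bigcap_(k in [set: seq_sub s]) [set h | h (val k) = c k].
have -> : g @^-1` Y = \bigcup_(c in [set c | pat c `&` g @^-1` Y !=set0]) pat c.
  apply/seteqP; split => [h Yh|h [c [k [kc Yk]] hc]].
    exists [ffun k : seq_sub s => h (val k)]; last by move=> k _ /=; rewrite ffunE.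
    by exists h; split => // k _ /=; rewrite ffunE.
  rewrite /preimage /= (gs _ k) // => v vs.
  by have := hc (SeqSub vs) I; have := kc (SeqSub vs) I => /= -> ->.
apply: fin_bigcup_measurable; first exact: finite_finset.
move=> c _; apply: fin_bigcap_measurable; first exact: finite_finset.
by move=> k _; apply: sub_sigma_algebra; exists (val k), (c k).
Qed.

End Configurations.

Section Specification.
Variables (R : realType) (V : choiceType).

Definition kernel_family :=
  forall L : {fset V}, (outside L -> spin) -> fdist R {ffun L -> spin}.

Definition kernel_apply (g : kernel_family) (L : {fset V}) (f : config V -> R)
    (h : outside L -> spin) : R :=
  \sum_(w : {ffun L -> spin}) g L h w * f (glue w h).

(* A probability kernel for each finite L, depending measurably on the spins
   outside L; properness is built into glue. The kernels are finite sums, so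
   consistency for bounded measurable f is the same as for all f. *)
Record specification := Specification {
  kernel : kernel_family;
  kernel_measurable : forall (L : {fset V}) (w : {ffun L -> spin}),
    measurable_fun setT
      (fun h : g_sigma_algebraType (@cylinders_out V L) => kernel h w);
  kernel_consistent : forall (D L : {fset V}) (f : config V -> R)
      (h : outside L -> spin), (D `<=` L)%fset ->
    kernel_apply kernel (fun x => kernel_apply kernel f (@res_out V D x)) h =
    kernel_apply kernel f h }.

Variable g : specification.

Definition single_site (i : V) (x : config V) (a : spin) : R :=
  \sum_(w : {ffun [fset i]%fset -> spin} | w [` fset11 i]%fset == a)
    kernel g (@res_out V [fset i]%fset x) w.

Definition dobrushin_coef (i j : V) : \bar R :=
  ereal_sup [set r | exists x y : config V, (forall k, k != j -> x k = y k) /\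
    r = (d_TV (single_site i x) (single_site i y))%:E].

Definition dobrushin_constant : \bar R :=
  ereal_sup [set \esum_(j in [set: V]) dobrushin_coef i j | i in [set: V]].

Definition local_fun (f : config V -> R) : Prop :=
  exists F : {fset V}, forall x y, {in F, x =1 y} -> f x = f y.

Definition uniform_limit_of_local (f : config V -> R) : Prop :=
  exists u : nat -> config V -> R,
    (forall n, local_fun (u n)) /\ {uniform, u @ \oo --> f}.

Definition quasilocal : Prop := forall (L : {fset V}) (f : config V -> R),
  uniform_limit_of_local f ->
  uniform_limit_of_local (fun x => kernel_apply (kernel g) f (@res_out V L x)).

Definition dobrushin_condition : Prop :=
  (dobrushin_constant < 1)%E /\ quasilocal.

End Specification.

Section SoftCore.
Variables (R : realType) (V : choiceType) (G : graph V).
Variables (beta : R) (alpha : fdist R spin).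

(* An edge [fset i; j] has i != j, so the product over it is x i * x j. *)
Definition clash (x : config V) (e : {fset V}) : bool :=
  \prod_(v <- e) ssval (x v) == -1.

Lemma clash_edge x i j : i != j ->
  clash x [fset i; j]%fset = (ssval (x i) * ssval (x j) == -1).
Proof. by move=> ij; rewrite /clash big_fsetU1 ?inE //= big_seq_fset1. Qed.

Definition clashes (L : {fset V}) (x : config V) : R :=
  \sum_(e \in edges_meeting G L) ((clash x e)%:R : R).

Definition sc_weight (L : {fset V}) (h : outside L -> spin)
    (w : {ffun L -> spin}) : R :=
  expR (- beta * clashes L (glue w h)) * \prod_(i : L) alpha (w i).

Definition sc_partition (L : {fset V}) (h : outside L -> spin) : R :=
  \sum_(w : {ffun L -> spin}) sc_weight h w.

Lemma sc_weight_ge0 L h w : 0 <= @sc_weight L h w.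
Proof.
by rewrite mulr_ge0 ?expR_ge0 // prodr_ge0 // => i _; exact: pmf_ge0.
Qed.

Lemma sc_partition_gt0 L h : 0 < @sc_partition L h.
Proof.
have [a a0] : exists a, 0 < alpha a.
  apply: contrapT => /forallNP a0; have := pmf_sum1 alpha.
  rewrite big1 => [/esym/eqP|a _]; first by rewrite oner_eq0.
  by apply/eqP; rewrite eq_le pmf_ge0 leNgt andbT; apply/negP/a0.
rewrite /sc_partition (bigD1 [ffun=> a]) //= ltr_pwDl //; last first.
  by apply: sumr_ge0 => w _; exact: sc_weight_ge0.
by rewrite mulr_gt0 ?expR_gt0 // prodr_gt0 // => i _; rewrite ffunE.
Qed.

Lemma sc_pmf_ge0 L h w : 0 <= @sc_weight L h w / sc_partition h.
Proof. by rewrite divr_ge0 ?sc_weight_ge0 // ltW // sc_partition_gt0. Qed.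

Lemma sc_pmf_sum1 (L : {fset V}) h :
  \sum_(w : {ffun L -> spin}) @sc_weight L h w / sc_partition h = 1.
Proof. by rewrite -mulr_suml divff // gt_eqF // sc_partition_gt0. Qed.

Definition sc_kernel : kernel_family R V := fun L h =>
  FDist (@sc_pmf_ge0 L h) (@sc_pmf_sum1 L h).

Hypothesis lf : locally_finite G.

Lemma clashes_local L : exists F : {fset V}, forall x y,
  {in F, x =1 y} -> clashes L x = clashes L y.
Proof.
have [F FP] := edges_meeting_cover L lf; exists F => x y xy.
apply: eq_fsbigr => e /set_mem Le; congr ((_ == _)%:R).
by rewrite !big_seq; apply: eq_bigr => v /(FP _ _ Le) /xy ->.
Qed.

Lemma sc_kernel_measurable (L : {fset V}) (w : {ffun L -> spin}) :
  measurable_fun setT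
    (fun h : g_sigma_algebraType (@cylinders_out V L) => sc_kernel h w).
Proof.
have [F FP] := clashes_local L.
apply: (@finitely_dependent_measurable _ _ _ _ (pmap insub F)) => h k hk /=.
have E u : sc_weight h u = sc_weight k u.
  rewrite /sc_weight; congr (expR (_ * _) * _); apply: FP => v vF.
  case: (boolP (v \in L)) => vL; first by rewrite !(glue_in _ _ vL).
  by rewrite !(glue_out _ _ vL) hk // mem_pmap_sub.
by rewrite E /sc_partition; under eq_bigr do rewrite E.
Qed.

Definition cfg_weight (L : {fset V}) (x : config V) : R :=
  expR (- beta * clashes L x) * \prod_(i <- L) alpha (x i).

Lemma sc_weightE L h w : @sc_weight L h w = cfg_weight L (glue w h).
Proof.
rewrite /sc_weight /cfg_weight big_seq_fsetE /=; congr (_ * _).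
by apply: eq_bigr => i _; rewrite (glue_in _ _ (valP i)); congr (alpha (w _)); apply/val_inj.
Qed.

Lemma cfg_weight_swap (D L : {fset V}) x y : (D `<=` L)%fset ->
  @res_out V D x = @res_out V D y ->
  cfg_weight L x * cfg_weight D y = cfg_weight L y * cfg_weight D x.
Proof.
move=> DL xy.
have {}xy v : v \notin D -> x v = y v.
  by move=> vD; have := congr1 (@^~ (exist _ v vD)) xy.
have sub : edges_meeting G D `<=` edges_meeting G L.
  move=> e [Ge /fset0Pn[v vD]]; split => //; apply/fset0Pn; exists v.
  by move: vD; rewrite !inE => /andP[-> /(fsubsetP DL)].
have [c cE] : exists c, forall z, z = x \/ z = y -> clashes L z = clashes D z + c.
  pose rest z : R := \sum_(e \in edges_meeting G L `\` edges_meeting G D)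
      ((clash z e)%:R : R).
  have restE z : clashes L z = clashes D z + rest z.
    by rewrite /clashes (fsbigID (edges_meeting G D)) ?(setIidr sub) //;
      exact: edges_meeting_finite.
  exists (rest x) => z [->|->]; first exact: restE.
  rewrite restE; congr (_ + _); apply: eq_fsbigr => e /set_mem[[Ge _] eD].
  congr ((nat_of_bool (_ == _))%:R); rewrite !big_seq; apply: eq_bigr => v ve; rewrite xy //.
  apply/negP => vD; apply: eD; split => //; apply/fset0Pn; exists v.
  by rewrite inE ve.
rewrite /cfg_weight !cE; [|by right|by left].
have pE z : \prod_(i <- L) alpha (z i) =
    \prod_(i <- D) alpha (z i) * \prod_(i <- (L `\` D)%fset) alpha (z i).
  rewrite (big_fsetID _ (mem D)) /=.
  congr (_ * _); apply: eq_fbigl => i; rewrite !inE /=.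
    by case: (boolP (i \in D)) => [/(fsubsetP DL) ->|]; rewrite ?andbF.
  by rewrite andbC.
have -> : \prod_(i <- L) alpha (x i) =
    \prod_(i <- D) alpha (x i) * \prod_(i <- (L `\` D)%fset) alpha (y i).
  rewrite pE; congr (_ * _); rewrite !big_seq; apply: eq_bigr => i.
  by rewrite inE => /andP[/xy ->].
rewrite pE !mulrDr !expRD; ring.
Qed.

Lemma sc_kernel_consistent (D L : {fset V}) (f : config V -> R)
    (h : outside L -> spin) : (D `<=` L)%fset ->
  kernel_apply sc_kernel (fun x => kernel_apply sc_kernel f (@res_out V D x)) h =
  kernel_apply sc_kernel f h.
Proof.
move=> DL; rewrite /kernel_apply /=.
pose T := ({ffun L -> spin} * {ffun D -> spin})%type.
pose X (p : T) := glue p.1 h.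
pose P (p : T) := glue p.2 (@res_out V D (X p)).
pose s (p : T) : T := (res_in L (P p), res_in D (X p)).
have outP p : @res_out V L (P p) = h.
  apply/funext => -[v vL]; rewrite /res_out /P /=.
  have vD : v \notin D by apply: contra vL; exact/fsubsetP.
  by rewrite (glue_out _ _ vD) /res_out /= /X (glue_out _ _ vL).
have Xs p : X (s p) = P p.
  by rewrite /X /s /= -[in LHS](outP p) glue_res.
have Ps p : P (s p) = X p.
  by rewrite /P Xs /s /= res_out_glue; exact: glue_res.
have ss : involutive s.
  by move=> [a b]; rewrite {1}/s Ps Xs /X /P /= !res_in_glue.
have outX p : @res_out V D (P p) = @res_out V D (X p) by rewrite res_out_glue.
under eq_bigr do rewrite mulr_sumr.
rewrite pair_bigA /= (reindex_inj (inv_inj ss)) /=.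
rewrite (eq_bigr (fun p : T => sc_weight h p.1 / sc_partition h * f (X p) *
    (sc_weight (@res_out V D (X p)) p.2 / sc_partition (@res_out V D (X p))))).
  rewrite -(pair_bigA _ (fun w v => sc_weight h w / sc_partition h *
      f (glue w h) * (sc_weight (@res_out V D (glue w h)) v /
      sc_partition (@res_out V D (glue w h))))) /=.
  by apply: eq_bigr => w _; rewrite -mulr_sumr sc_pmf_sum1 mulr1.
move=> p _; rewrite -[glue (res_in L (P p)) h]/(X (s p)) Xs outX.
rewrite (glue_res (esym (erefl (@res_out V D (X p))))) !sc_weightE.
rewrite -[glue (res_in L (P p)) h]/(X (s p)) Xs (glue_res erefl).
rewrite -/(X p) -/(P p).
have := cfg_weight_swap DL (outX p).
set a := cfg_weight L _; set b := cfg_weight D _.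
set c := cfg_weight L _; set d := cfg_weight D _ => E.
rewrite [LHS](_ : _ = a * b / sc_partition h /
  sc_partition (@res_out V D (X p)) * f (X p)); last by ring.
by rewrite E; ring.
Qed.

Definition softcore_WR : specification R V :=
  Specification sc_kernel_measurable sc_kernel_consistent.

End SoftCore.

(* Main.v *)
Require Import Defs.
From mathcomp Require Import all_boot all_order all_algebra finmap.
From mathcomp Require Import all_classical all_reals all_analysis.
From mathcomp Require Import ring lra.

Set Implicit Arguments.
Unset Strict Implicit.

Import Order.TTheory GRing.Theory Num.Theory.
Import numFieldNormedType.Exports.
Local Open Scope classical_set_scope.
Local Open Scope ring_scope.

(** The law of the spin at [i] only sees the neighbours of [i], and one edge
    joins [i] to a given neighbour [j].  Changing the spin at [j] thus changes
    the energy of every value of the spin at [i] by at most one clash, so each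
    unnormalised weight moves by a factor between [expR (- beta)] and
    [expR beta], whatever the a priori measure [alpha] is.  Once both laws are
    normalised, the odds between any two spin values move by a factor
    of at most [expR beta ^+ 2], and two laws in this relation are at total
    variation distance at most
      [(expR beta - 1) / (expR beta + 1) = tanh (beta / 2) <= beta / 2]
    ([d_TV_odds_ratio], [expR_tanh_half_le]).  Hence [C_ij] is at most
    [beta / 2] when [j] is a neighbour of [i] and vanishes otherwise, a row of
    the Dobrushin matrix sums to at most [degree i * (beta / 2)], and the
    Dobrushin constant is at most [B * beta / 2 < 1].

    The weaker bound obtained by comparing the normalised densities directly
    (each moves by a factor of at most [expR beta ^+ 2]) would lose the
    constant 2 in the hypothesis [beta * B < 2]; working with odds rather than
    with densities is what makes the threshold come out right.

    Quasilocality holds because the range of interaction is finite: each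
    kernel depends on finitely many spins of the boundary condition, hence
    maps local functions to local functions, and averaging against a
    probability does not increase the uniform distance. *)

(** * Total variation and ratios of odds *)

(** With [p] and [x] the probabilities of one event under two laws, the
    hypothesis says that the odds grow by a factor of at most [s ^+ 2].  The gap
    [x - p] is largest at [p = 1 / (s + 1)]; this is the equality case of
    [((s + 1) * p - 1) ^+ 2 >= 0], to which the claim reduces. *)
Lemma odds_ratio_gap (R : realFieldType) (s p x : R) :
  1 <= s -> 0 <= p -> p <= 1 ->
  x * (1 - p) <= s ^+ 2 * (p * (1 - x)) -> x - p <= (s - 1) / (s + 1).
Proof.
move=> s1 p0 p1 h.
have s2 : 0 <= s ^+ 2 - 1 by nra.
have pos : 0 < 1 + (s ^+ 2 - 1) * p by apply: ltr_pwDl => //; exact: mulr_ge0.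
rewrite ler_pdivlMr; last by lra.
rewrite -(ler_pM2r pos).
have D : (x - p) * (1 + (s ^+ 2 - 1) * p) <= (s ^+ 2 - 1) * (p * (1 - p)).
  by rewrite -subr_ge0; move: h; rewrite -subr_ge0; congr (0 <= _); ring.
have Q : (s + 1) ^+ 2 * (p * (1 - p)) <= 1 + (s ^+ 2 - 1) * p.
  rewrite -subr_ge0 [X in 0 <= X](_ : _ = ((s + 1) * p - 1) ^+ 2); last by ring.
  exact: sqr_ge0.
apply: (@le_trans _ _ ((s - 1) * ((s + 1) ^+ 2 * (p * (1 - p))))).
  have := ler_wpM2l (_ : 0 <= s + 1) D.
  rewrite [X in _ -> X <= _]mulrAC [X in _ -> X <= _]mulrC.
  move=> /(_ ltac:(lra)) /le_trans; apply.
  by rewrite le_eqVlt; apply/orP; left; apply/eqP; ring.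
by apply: ler_wpM2l => //; lra.
Qed.

(** The total variation distance is attained on the event [m < n], and the
    pointwise comparison of odds, summed over that event and its complement,
    is the comparison of the odds of the event. *)
Lemma d_TV_odds_ratio (R : realType) (T : finType) (m n : T -> R) (s : R) :
  1 <= s -> (forall a, 0 <= m a) ->
  \sum_a m a = 1 -> \sum_a n a = 1 ->
  (forall a b, n a * m b <= s ^+ 2 * (m a * n b)) ->
  d_TV m n <= (s - 1) / (s + 1).
Proof.
move=> s1 m0 sm sn h.
pose A : pred T := fun a => m a < n a.
pose p := \sum_(a | A a) m a; pose x := \sum_(a | A a) n a.
have pC : \sum_(a | ~~ A a) m a = 1 - p.
  by rewrite -sm [in RHS](bigID A) /= addrAC subrr add0r.
have xC : \sum_(a | ~~ A a) n a = 1 - x.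
  by rewrite -sn [in RHS](bigID A) /= addrAC subrr add0r.
have -> : d_TV m n = x - p.
  rewrite /d_TV (bigID A) /=.
  rewrite (eq_bigr (fun a => n a - m a)); last first.
    by move=> a Aa; rewrite distrC ger0_norm // subr_ge0 ltW.
  rewrite [X in _ + X](eq_bigr (fun a => m a - n a)); last first.
    by move=> a Aa; rewrite ger0_norm // subr_ge0 leNgt.
  by rewrite !sumrB pC xC -/x -/p; field.
have p0 : 0 <= p by exact: sumr_ge0.
apply: odds_ratio_gap => //.
  by rewrite -subr_ge0 -pC; exact: sumr_ge0.
rewrite -pC -xC /x /p !big_distrl /= mulr_sumr; apply: ler_sum => a _.
by rewrite !mulr_sumr; apply: ler_sum => b _.
Qed.

(** The left-hand side is [tanh (b / 2)].  Clearing the denominator leaves a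
    function vanishing at 0, whose derivative [1 - expR x * (1 - x)] is
    nonnegative because [1 - x <= expR (- x)]. *)
Lemma expR_tanh_half_le (R : realType) (b : R) : 0 <= b ->
  (expR b - 1) / (expR b + 1) <= b / 2.
Proof.
move=> b0.
have e0 := expR_gt0 b.
rewrite ler_pdivrMr; last by lra.
pose f (x : R) := x * (expR x + 1) - 2 * (expR x - 1).
have fD (x : R) : is_derive x 1 f (1 - expR x * (1 - x)).
  by apply: is_derive_eq; rewrite /GRing.scale /=; ring.
suff : f 0 <= f b by rewrite /f expR0; lra.
apply: (@ger0_derive1_ndecr R f 0 b) => //.
- move=> x _; rewrite derive1E derive_val subr_ge0.
  rewrite -(ler_pM2l (expR_gt0 (- x))) mulr1 mulrA -expRD addNr expR0 mul1r.
  exact: expR_ge1Dx.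
- apply: continuous_subspaceT => x; apply: differentiable_continuous.
  exact/derivable1_diffP.
Qed.

(** * Quasilocality *)

Lemma uniform_cvg_normP (R : realType) (U : choiceType) (u : nat -> U -> R)
    (f : U -> R) :
  {uniform, u @ \oo --> f} <->
  (forall e, 0 < e -> \forall n \near \oo, forall x, `|f x - u n x| < e).
Proof.
split=> [uf e e0|uf P].
  apply: (uf [set h | forall x, `|f x - h x| < e]).
  apply/uniform_nbhs; exists [set xy | ball xy.1 e xy.2]; split.
    exact: (entourage_ball _ (PosNum e0)).
  by move=> h /= hE x; exact: (hE x I).
move=> /uniform_nbhs[E [+ EP]]; rewrite -entourage_ballE => -[e /= e0 eE].
have := uf e e0; apply: filterS => n un; apply: EP => x _.
by apply: eE; exact: un.
Qed.

Lemma eq_glue_res_out (V : choiceType) (L : {fset V}) (w : {ffun L -> spin})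
    (x y : config V) (k : V) : x k = y k ->
  Defs.glue w (@res_out V L x) k = Defs.glue w (@res_out V L y) k.
Proof.
move=> xyk; case: (boolP (k \in L)) => kL; first by rewrite !(glue_in _ _ kL).
by rewrite !(glue_out _ _ kL) /res_out /=.
Qed.

(** Applying the kernels to local approximations [u n] of [f] gives local
    approximations of the image of [f]: the spins needed are those on which
    the kernel and [u n] depend, and averaging contracts the uniform norm. *)
Lemma quasilocal_of_local_kernels (R : realType) (V : choiceType)
    (g : specification R V) :
  (forall L : {fset V}, exists F : {fset V}, forall x y : config V,
     {in F, x =1 y} ->
     Defs.kernel g (@res_out V L x) =1 Defs.kernel g (@res_out V L y)) ->
  quasilocal g.
Proof.
move=> gloc L f [u [uloc uf]].
exists (fun n x => kernel_apply (Defs.kernel g) (u n) (@res_out V L x)); split.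
  move=> n; have [F FP] := gloc L; have [F' F'P] := uloc n.
  exists (F `|` F')%fset => x y xy.
  apply: eq_bigr => w _; rewrite (FP x y); last first.
    by move=> v vF; apply: xy; rewrite inE vF.
  congr (_ * _); apply: F'P => v vF'; apply: eq_glue_res_out.
  by rewrite xy // inE vF' orbT.
apply/uniform_cvg_normP => e e0.
have e20 : 0 < e / 2 by exact: divr_gt0.
have := (uniform_cvg_normP u f).1 uf _ e20.
apply: filterS => n un x; rewrite /kernel_apply -sumrB.
apply: (@le_lt_trans _ _ (e / 2)); last by lra.
(* The literal [2] contains the [1] that becomes the total mass of the kernel
   below, so [e / 2] is first made opaque. *)
move: (e / 2) un => d un.
apply: le_trans (ler_norm_sum _ _ _) _.
rewrite -[leRHS]mul1r -(Defs.pmf_sum1 (Defs.kernel g (@res_out V L x))).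
rewrite mulr_suml.
apply: ler_sum => w _; rewrite -mulrBr normrM ger0_norm ?Defs.pmf_ge0 //.
by apply: ler_wpM2l; [exact: Defs.pmf_ge0|exact/ltW/un].
Qed.

Lemma softcore_quasilocal (R : realType) (V : choiceType) (G : graph V)
    (lf : locally_finite G) (beta : R) (alpha : fdist R spin) :
  quasilocal (softcore_WR beta alpha lf).
Proof.
apply: quasilocal_of_local_kernels => L.
have [F FP] := clashes_local R lf L; exists F => x y xy w /=.
have E u : sc_weight G beta alpha (@res_out V L x) u =
           sc_weight G beta alpha (@res_out V L y) u.
  rewrite /sc_weight; congr (expR (_ * _) * _); apply: FP => v vF.
  by apply: eq_glue_res_out; exact: xy.
by rewrite E /sc_partition; under eq_bigr do rewrite E.
Qed.

(** * Influence of one boundary spin on the law at a site *)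

Lemma eq_clash (V : choiceType) (x y : config V) (e : {fset V}) :
  {in e, x =1 y} -> clash x e = clash y e.
Proof.
move=> xy; rewrite /clash; congr (_ == _).
by rewrite !big_seq; apply: eq_bigr => v /xy ->.
Qed.

Lemma edge_meeting_set1 (V : choiceType) (G : graph V) (i j : V)
    (e : {fset V}) : i != j ->
  edges_meeting G [fset i]%fset e -> j \in e -> e = [fset i; j]%fset.
Proof.
move=> ij [Ge /fset0Pn[k]]; rewrite !inE => /andP[ke /eqP ki] je.
have ie : i \in e by rewrite -ki.
have [a [b [_ eE]]] := edgeP Ge.
move: ie je ij; rewrite eE !inE => /orP[] /eqP-> /orP[] /eqP-> //.
- by rewrite eqxx.
- by rewrite fsetUC.
- by rewrite eqxx.
Qed.

Lemma single_site_ge0 (R : realType) (V : choiceType)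
    (g : specification R V) (i : V) (x : config V) (a : spin) :
  0 <= single_site g i x a.
Proof. by apply: sumr_ge0 => w _; exact: Defs.pmf_ge0. Qed.

Lemma single_site_sum1 (R : realType) (V : choiceType)
    (g : specification R V) (i : V) (x : config V) :
  \sum_a single_site g i x a = 1.
Proof.
rewrite -(Defs.pmf_sum1 (Defs.kernel g (@res_out V [fset i]%fset x))).
by rewrite [RHS](partition_big
  (fun w : {ffun [fset i]%fset -> spin} => w [` fset11 i]%fset) xpredT).
Qed.

Section SingleSite.
Variables (R : realType) (V : choiceType) (G : graph V).
Hypothesis lf : locally_finite G.

Lemma clashes_site_non_nbr (i j : V) (x y : config V) :
  (forall k, k != j -> x k = y k) -> i != j -> ~ nbrs G i j ->
  clashes R G [fset i]%fset x = clashes R G [fset i]%fset y.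
Proof.
move=> xy ij nij; apply: eq_fsbigr => e /set_mem Le; congr (_%:R).
congr nat_of_bool; apply: eq_clash => v ve; apply: xy.
apply: contra_not_neq nij => vj; rewrite vj in ve.
by rewrite /nbrs /= -(edge_meeting_set1 ij Le ve); case: Le.
Qed.

(** Only the edge [{i, j}] among those meeting [i] sees the spin at [j]. *)
Lemma clashes_site_nbr (i j : V) (x y : config V) :
  (forall k, k != j -> x k = y k) -> i != j -> nbrs G i j ->
  clashes R G [fset i]%fset x <= clashes R G [fset i]%fset y + 1.
Proof.
move=> xy ij nij.
have ijL : edges_meeting G [fset i]%fset [fset i; j]%fset.
  by split => //; apply/fset0Pn; exists i; rewrite !inE eqxx.
have fin := edges_meeting_finite [fset i]%fset lf.
pose rest (z : config V) : R := \sum_(e \in edges_meeting G [fset i]%fset `\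
  [fset i; j]%fset) ((clash z e)%:R : R).
have split_ij (z : config V) : clashes R G [fset i]%fset z =
    (clash z [fset i; j]%fset)%:R + rest z.
  exact: (fsbigD1 [fset i; j]%fset).
have -> : clashes R G [fset i]%fset x =
    (clash x [fset i; j]%fset)%:R + rest y; last first.
  by rewrite split_ij; move: (rest y) => r;
    case: (clash x _); case: (clash y _) => /=; lra.
rewrite split_ij; congr (_ + _); apply: eq_fsbigr => e /set_mem[Le eij].
congr (nat_of_bool _)%:R; apply: eq_clash => v ve.
apply: xy; apply/eqP => vj; apply: eij => /=.
by rewrite (edge_meeting_set1 ij Le) // -vj.
Qed.

Variables (beta : R) (alpha : fdist R spin).
Hypothesis beta_ge0 : 0 <= beta.

Let g := softcore_WR beta alpha lf.

Let site_weight (i : V) (x : config V) (a : spin) : R :=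
  \sum_(w : {ffun [fset i]%fset -> spin} | w [` fset11 i]%fset == a)
    sc_weight G beta alpha (@res_out V [fset i]%fset x) w.

Lemma single_siteE (i : V) (x : config V) (a : spin) :
  single_site g i x a = site_weight i x a /
    sc_partition G beta alpha (@res_out V [fset i]%fset x).
Proof. by rewrite /site_weight mulr_suml. Qed.

Lemma single_site_non_nbr (i j : V) (x y : config V) :
  (forall k, k != j -> x k = y k) -> ~ nbrs G i j ->
  single_site g i x = single_site g i y.
Proof.
move=> xy nij.
have W w : sc_weight G beta alpha (@res_out V [fset i]%fset x) w =
           sc_weight G beta alpha (@res_out V [fset i]%fset y) w.
  (* The law at [i] is not a function of the spin at [i] itself. *)
  have [ij|ij] := eqVneq i j.
    have -> // : @res_out V [fset i]%fset x = @res_out V [fset i]%fset y.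
    apply/funext => -[v vi]; apply: (xy v); rewrite -ij.
    by rewrite -(in_fset1 i).
  congr (expR (_ * _) * _).
  exact: (clashes_site_non_nbr
    (fun k kj => eq_glue_res_out w (xy k kj)) ij nij).
apply/funext => a; rewrite !single_siteE /site_weight /sc_partition.
by congr (_ / _); apply: eq_bigr => w _; exact: W.
Qed.

(** One edge changes the energy by at most [beta]; the a priori weights are the
    same on both sides. *)
Lemma site_weight_nbr (i j : V) (x y : config V) (a : spin) :
  (forall k, k != j -> x k = y k) -> nbrs G i j ->
  site_weight i x a <= expR beta * site_weight i y a.
Proof.
move=> xy nij.
have ij : i != j.
  apply/eqP => ij; move: nij; rewrite /nbrs /= ij fsetUid => /edges_card2.
  by rewrite cardfs1.
rewrite /site_weight mulr_sumr; apply: ler_sum => w _.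
rewrite /sc_weight mulrA -expRD; apply: ler_wpM2r.
  by apply: prodr_ge0 => v _; exact: Defs.pmf_ge0.
rewrite ler_expR.
(* The edge bound is applied from [y] to [x], as the energy carries a minus. *)
have H := clashes_site_nbr (fun k kj =>
  esym (eq_glue_res_out w (xy k kj))) ij nij.
have := ler_wpM2l beta_ge0 H; lra.
Qed.

(** Multiplying the weight bounds at two spin values, in opposite directions,
    cancels both normalisations: this is a comparison of odds with factor
    [expR beta ^+ 2]. *)
Lemma d_TV_single_site_nbr (i j : V) (x y : config V) :
  (forall k, k != j -> x k = y k) -> nbrs G i j ->
  d_TV (single_site g i x) (single_site g i y) <= beta / 2.
Proof.
move=> xy nij; apply: le_trans (expR_tanh_half_le beta_ge0).
apply: d_TV_odds_ratio; rewrite ?single_site_sum1 //.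
- by rewrite -expR0 ler_expR.
- exact: single_site_ge0.
move=> a b; rewrite !single_siteE.
have sw0 z c : 0 <= site_weight i z c.
  by apply: sumr_ge0 => w _; exact: sc_weight_ge0.
have yx := site_weight_nbr a (fun k kj => esym (xy k kj)) nij.
have xy' := site_weight_nbr b xy nij.
set Zx := sc_partition _ _ _ (res_out x).
set Zy := sc_partition _ _ _ (res_out y).
rewrite [leLHS](_ : _ = site_weight i y a * site_weight i x b *
  (Zx^-1 * Zy^-1)); last by ring.
rewrite [leRHS](_ : _ = (expR beta * site_weight i x a) *
  (expR beta * site_weight i y b) * (Zx^-1 * Zy^-1)); last by ring.
apply: ler_wpM2r; last exact: ler_pM.
by rewrite mulr_ge0 // invr_ge0 ltW // sc_partition_gt0.
Qed.

(** * The Dobrushin matrix *)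

Lemma dobrushin_coef_softcore_le (i j : V) :
  (dobrushin_coef g i j <= if j \in nbrs G i then (beta / 2)%:E else 0)%E.
Proof.
apply: ge_ereal_sup => _ [x [y [xy ->]]]; case: ifPn => [/set_mem|/negP] nij.
  by rewrite lee_fin; exact: (d_TV_single_site_nbr xy).
rewrite (@single_site_non_nbr _ _ _ _ xy) => [|nij']; last first.
  by apply: nij; exact: mem_set.
by rewrite /d_TV big1 ?mulr0 // => a _; rewrite subrr normr0.
Qed.

Lemma dobrushin_row_softcore_le (i : V) :
  (\esum_(j in [set: V]) dobrushin_coef g i j <=
     ((degree G i)%:R * (beta / 2))%:E)%E.
Proof.
apply: (@le_trans _ _ (\esum_(j in nbrs G i) (beta / 2)%:E)).
  by rewrite [leRHS]esum_mkcond; apply: le_esum => j _;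
    exact: dobrushin_coef_softcore_le.
rewrite esum_fset //; last by move=> j _; rewrite lee_fin divr_ge0.
rewrite fsbig_finite //= sumEFin lee_fin big_const_seq count_predT iter_addr_0.
by rewrite mulr_natl.
Qed.

End SingleSite.

Unset Implicit Arguments.
Set Strict Implicit.

Theorem theorem2p7 (R : realType) (V : choiceType) (G : graph V)
  (G_connected : connected_graph G)
  (G_locally_finite : locally_finite G)
  (V_infinite : infinite_set [set: V])
  (beta : R) (beta_gt0 : 0 < beta)
  (beta_B_lt2 : (beta%:E * max_degree G R < 2%:E)%E)
  (alpha : fdist R spin) :
  dobrushin_condition (softcore_WR beta alpha G_locally_finite).
Proof.
split; last exact: softcore_quasilocal.
have [i0 _] : [set: V] !=set0.
  by apply/set0P/eqP => V0; apply: V_infinite; rewrite V0.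
have degB i : ((degree G i)%:R%:E <= max_degree G R)%E.
  by apply: ereal_sup_ubound; exists i.
(* An infinite maximal degree would make the product infinite, as [beta > 0];
   a vertex excludes the supremum of the empty set. *)
have [B BE] : exists B : R, max_degree G R = B%:E.
  move: (degB i0) beta_B_lt2; case: (max_degree G R) => [B _ _|_|].
  - by exists B.
  - by rewrite mulry gtr0_sg // mul1e ltNge leey.
  - by rewrite leeNy_eq.
have B2 : beta * B < 2 by move: beta_B_lt2; rewrite BE -EFinM lte_fin.
apply: (@le_lt_trans _ _ (B * (beta / 2))%:E); last by rewrite lte_fin; lra.
apply: ge_ereal_sup => _ [i _ <-].
apply: le_trans (dobrushin_row_softcore_le _ _ (ltW beta_gt0) i) _.
rewrite lee_fin; apply: ler_wpM2r; first by rewrite divr_ge0 // ltW.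
by have := degB i; rewrite BE lee_fin.
Qed.
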